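(* Let $R$ be a reduced commutative ring with identity. The following statements are equivalent. (a) The space of prime ideals $\mathrm{Spec}(R)$ is an EZ-space. (b) For every ideal $I$ of $R$ there exists a subset $E$ of idempotents of $R$ such that $\mathrm{Ann}(I)=\mathrm{Ann}(E)$. (c) For every $a\in R$ there exists a subset $S$ of idempotents of $R$ such that $\mathrm{Ann}(a)=\mathrm{Ann}(S)$. (d) For every $a\in R$ there exists a subset $S$ of idempotents of $R$ such that $\mathrm{cl}(\mathrm{supp}(a))=\mathrm{cl}\big(\bigcup_{e\in S}\mathrm{supp}(e)\big)$ in $\mathrm{Spec}(R)$.
   Context: For a subset $S$ of $R$, $\mathrm{Ann}(S)=\{r\in R: rs=0\text{ for all }s\in S\}$. $\mathrm{Spec}(R)$ carries the Zariski topology, with basic open sets $\mathrm{supp}(a)=\{P\in\mathrm{Spec}(R): a\notin P\}$, $a\in R$. A topological space $Y$ is an EZ-space if for every open subset $A$ of $Y$ there is a collection $\{A_\alpha:\alpha\in S\}$ of clopen subsets of $Y$ with $\mathrm{cl}_Y A=\mathrm{cl}_Y(\bigcup_{\alpha\in S}A_\alpha)$. *)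

(* Defs.v *)
From HB Require Import structures.
From mathcomp Require Import all_boot all_order all_algebra.
From mathcomp Require Import boolp classical_sets topology.

Set Implicit Arguments.
Unset Strict Implicit.
Unset Printing Implicit Defensive.

Import GRing.Theory.
Local Open Scope classical_set_scope.
Local Open Scope ring_scope.

(* Rings are [comPzRingType]s, so the zero ring is allowed. *)

Definition reduced (R : comPzRingType) : Prop :=
  forall (x : R) (n : nat), x ^+ n = 0 -> x = 0.

Definition Ann (R : comPzRingType) (S : set R) : set R :=
  [set r | forall s, S s -> r * s = 0].

Definition idempotents (R : comPzRingType) : set R := [set e | e * e = e].
Arguments idempotents R : clear implicits.

(* Unlike [idealr] of ring_quotient, this does not exclude the whole ring and
   does not need 1 != 0. *)
Definition ideal (R : comPzRingType) (I : set R) : Prop :=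
  [/\ I 0, forall x y, I x -> I y -> I (x + y) & forall a x, I x -> I (a * x)].

Definition prime_ideal (R : comPzRingType) (P : set R) : Prop :=
  [/\ ideal P, ~ P 1 & forall x y, P (x * y) -> P x \/ P y].

Lemma prime_idealP (R : comNzRingType) (P : set R) :
  prime_ideal P <->
  idealr_closed (mem P) /\ prime_idealr_closed (mem P).
Proof.
split=> [[[P0 PD PM] P1 Pp]|[[P0 P1 PD] Pp]].
  split; first split.
  - exact/mem_set.
  - by apply/negP => /set_mem.
  - move=> a x y /set_mem Px /set_mem Py; apply/mem_set.
    by apply: (PD _ _ _ Py); exact: PM.
  - move=> x y /set_mem /Pp [Px|Py]; apply/orP.
      by left; exact/mem_set.
    by right; exact/mem_set.
split; first split.
- exact: set_mem P0.
- move=> x y Px Py; rewrite -(mul1r x); apply: set_mem.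
  by apply: PD; exact/mem_set.
- move=> a x Px; rewrite -(addr0 (a * x)); apply: set_mem.
  by apply: PD => //; exact/mem_set.
- by move=> /mem_set; apply/negP.
- by move=> x y /mem_set /Pp /orP[] /set_mem; [left|right].
Qed.

Record Spec (R : comPzRingType) := MkSpec {
  spec_set : set R;
  spec_prime : prime_ideal spec_set
}.

HB.instance Definition _ (R : comPzRingType) := gen_eqMixin (Spec R).
HB.instance Definition _ (R : comPzRingType) := gen_choiceMixin (Spec R).

Definition supp (R : comPzRingType) (a : R) : set (Spec R) :=
  [set P : Spec R | ~ spec_set P a].

Lemma supp1 (R : comPzRingType) : supp (1 : R) = setT.
Proof. by apply/seteqP; split=> // P _; case: (spec_prime P). Qed.

Lemma suppM (R : comPzRingType) (a b : R) : supp (a * b) = supp a `&` supp b.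
Proof.
apply/seteqP; split=> P; case: (spec_prime P) => -[_ _ PM] _ Pp; rewrite /supp /=.
  by move=> Pab; split=> ?; apply: Pab; [rewrite mulrC|]; exact: PM.
by move=> [Pa Pb] /Pp [].
Qed.

Section Zariski.
Variable R : comPzRingType.

Let supp_cover : \bigcup_(A in range (@supp R)) A = setT.
Proof.
apply/seteqP; split=> // P _; exists (supp 1); first by exists 1.
by rewrite supp1.
Qed.

Let supp_join (A B : set (Spec R)) (P : Spec R) :
  range (@supp R) A -> range (@supp R) B -> A P -> B P ->
  exists C, [/\ range (@supp R) C, C P & C `<=` A `&` B].
Proof.
move=> [a _ <-] [b _ <-] Pa Pb; exists (supp (a * b)).
by rewrite suppM; split=> //; exists (a * b) => //; rewrite suppM.
Qed.

HB.instance Definition _ :=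
  isBaseTopological.Build (Spec R) supp_cover supp_join.

End Zariski.

(* The index set of a collection plays no role: a collection of clopen sets is
   rendered as a set of sets. *)
Definition ez_space (Y : topologicalType) : Prop :=
  forall A : set Y, open A ->
    exists2 F : set (set Y), F `<=` clopen &
      closure A = closure (\bigcup_(U in F) U).

(* Main.v *)
(* In a reduced ring [supp a] is empty only for [a = 0], so [Ann S] and the
   closure of [\bigcup_(s in S) supp s] determine each other: [r \in Ann S] iff
   [supp r] misses that closure, and [P] lies in the closure iff [Ann S <= P].
   Together with the fact that the clopen subsets of [Spec R] are the [supp e]
   with [e] idempotent, this translates each condition into the others. *)
Require Import Defs.
From mathcomp Require Import all_boot all_order all_algebra.
From mathcomp Require Import boolp classical_sets topology.

Local Open Scope classical_set_scope.
Local Open Scope ring_scope.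

Import GRing.Theory.

Section SpecTopology.
Variable R : comPzRingType.
Implicit Types (a b e r x : R) (I S T : set R) (A U : set (Spec R)).

(* The chain condition is imposed on [I `|` J] rather than on [J] so that it
   also holds for the union of the empty chain. *)
Lemma prime_avoiding_powers I x : ideal I -> (forall n, ~ I (x ^+ n)) ->
  exists2 P : Spec R, I `<=` spec_set P & ~ spec_set P x.
Proof.
move=> [I0 ID IM] Ix.
pose good (J : set R) := ideal (I `|` J) /\ forall n, ~ (I `|` J) (x ^+ n).
have [|J [[[J0 JD JM] Jx] Jmax]] := @Zorn_bigcup R good.
  move=> F Fgood Ftot; split; last first.
    move=> n [/Ix//|[J FJ Jxn]]; have [_ /(_ n)] := Fgood _ FJ.
    by apply; right.
  split; first by left.
  - move=> u v [Iu|[J FJ Ju]] [Iv|[K FK Kv]].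
    + by left; exact: ID.
    + have [[_ KD _] _] := Fgood _ FK.
      by have [|h] := KD u v (or_introl Iu) (or_intror Kv); [left|right; exists K].
    + have [[_ JD _] _] := Fgood _ FJ.
      by have [|h] := JD u v (or_intror Ju) (or_introl Iv); [left|right; exists J].
    + have [JK|KJ] := Ftot _ _ FJ FK.
        have [[_ KD _] _] := Fgood _ FK.
        have [|h] := KD u v (or_intror (JK _ Ju)) (or_intror Kv); first by left.
        by right; exists K.
      have [[_ JD _] _] := Fgood _ FJ.
      have [|h] := JD u v (or_intror Ju) (or_intror (KJ _ Kv)); first by left.
      by right; exists J.
  - move=> a u [Iu|[J FJ Ju]]; first by left; exact: IM.
    have [[_ _ JM] _] := Fgood _ FJ.
    by have [|h] := JM a u (or_intror Ju); [left|right; exists J].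
pose Q := I `|` J.
(* Enlarging [Q] by a new element [y] gives the ideal [K]; by maximality it must contain a power of
   [x]. *)
have Qmax y : ~ Q y -> exists n q c, Q q /\ x ^+ n = q + c * y.
  move=> Qy; apply: contrapT => noxn.
  pose K := [set z | exists q c, Q q /\ z = q + c * y].
  have QK : Q `<=` K by move=> q Qq; exists q, 0; rewrite mul0r addr0.
  have IK : I `|` K = K.
    by apply/seteqP; split=> [z [Iz|//]|z]; [apply: QK; left|right].
  apply: (Jmax K).
    split; first by move=> z Jz; apply: QK; right.
    move=> KJ; apply: Qy; right; apply: KJ; exists 0, 1.
    by rewrite mul1r add0r.
  rewrite /good IK; split; last first.
    by move=> n [q [c [Qq xn]]]; apply: noxn; exists n, q, c.
  split; first exact: QK.
  - move=> _ _ [q [c [Qq ->]]] [q' [c' [Qq' ->]]]; exists (q + q'), (c + c').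
    by split; [exact: JD|rewrite mulrDl addrACA].
  - move=> a _ [q [c [Qq ->]]]; exists (a * q), (a * c).
    by split; [exact: JM|rewrite mulrDr mulrA].
have Qprime : prime_ideal Q.
  split=> //; first by move=> Q1; apply: (Jx 0%N); rewrite expr0.
  (* If neither factor lies in [Q], multiply the two expressions for powers of [x]: every term of
     the product has a factor [q], [q'] or [y * z], so [x ^+ (n + m)] falls into [Q]. *)
  move=> y z Qyz; apply: contrapT => /not_orP[/Qmax [n [q [c [Qq xn]]]]].
  move=> /Qmax [m [q' [c' [Qq' xm]]]]; apply: (Jx (n + m)%N).
  rewrite exprD xn xm mulrDl; apply: (JD); first by rewrite mulrC; exact: JM.
  by rewrite mulrDr; apply: JD; [exact: JM|rewrite mulrACA; exact: JM].
exists (MkSpec Qprime) => /=; first by move=> z Iz; left.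
by move=> Qx; apply: (Jx 1%N); rewrite expr1.
Qed.

Lemma ideal_in_no_prime I : ideal I ->
  (forall P : Spec R, ~ I `<=` spec_set P) -> I 1.
Proof.
move=> idI IP; apply: contrapT => I1.
have [|P /IP//] := @prime_avoiding_powers I 1 idI.
by move=> n; rewrite expr1n.
Qed.

(** If [a] is nonzero, reducedness keeps all its powers out of the zero ideal, so some prime avoids
    [a]. *)
Lemma supp_eq0 (hR : reduced R) a : supp a = set0 -> a = 0.
Proof.
move=> a0; apply: contrapT => aN0.
have [|n /hR//|P _ Pa] := @prime_avoiding_powers [set 0] a.
- by split=> //= [x y -> ->|b x ->]; rewrite ?addr0 ?mulr0.
- by have : supp a P by []; rewrite a0.
Qed.

Lemma supp0 : supp (0 : R) = set0.
Proof. by rewrite -subset0 => P; case: (spec_prime P) => -[P0 _ _] _ _. Qed.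

Lemma suppD a b : supp (a + b) `<=` supp a `|` supp b.
Proof.
move=> P; case: (spec_prime P) => -[_ PD _] _ _ Pab.
by apply: contrapT => /not_orP[/contrapT Pa /contrapT Pb]; apply/Pab/PD.
Qed.

Lemma open_supp a : open (supp a).
Proof. by exists [set supp a]; [move=> _ ->; exists a|rewrite bigcup_set1]. Qed.

Lemma nbhs_supp U (P : Spec R) : nbhs P U ->
  exists2 a, supp a P & supp a `<=` U.
Proof.
rewrite nbhsE => -[V [[D Dsupp <-] [B DB BP]] VU].
have [a _ aB] := Dsupp _ DB; exists a; rewrite aB // => Q BQ.
by apply: VU; exists B.
Qed.

Lemma open_disjoint_closure (Y : topologicalType) (V A : set Y) : open V ->
  V `&` closure A = set0 <-> V `&` A = set0.
Proof.
move=> oV; split=> VA; rewrite -subset0 => y [Vy Ay].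
  by rewrite -VA; split=> //; exact: subset_closure.
have [z [Az Vz]] := Ay V (open_nbhs_nbhs (conj oV Vy)).
by have : (V `&` A) z by []; rewrite VA.
Qed.

(** [e] and [1 - e] sum to [1], so no prime contains both; their product is [0], so every prime
    contains one. *)
Lemma idempotent_compl {e} : idempotents R e -> ~` supp e = supp (1 - e).
Proof.
move=> ee; apply/seteqP; split=> P.
  move=> /contrapT Pe; case: (spec_prime P) => -[_ PD _] P1 _ P1e; apply: P1.
  by rewrite -(subrK e 1); exact: PD.
move=> Pe' Pe; have : supp (e * (1 - e)) P by rewrite suppM.
by rewrite mulrBr mulr1 ee subrr supp0.
Qed.

Lemma clopen_supp e : idempotents R e -> clopen (supp e).
Proof.
move=> ide; split; first exact: open_supp.
by rewrite -openC (idempotent_compl ide); exact: open_supp.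
Qed.

Lemma ideal_supp_sub U : ideal [set r : R | supp r `<=` U].
Proof.
split=> /= [|x y xU yU P /suppD[/xU|/yU]//|a x xU P].
  by rewrite supp0; exact: sub0set.
by rewrite suppM => -[_ /xU].
Qed.

(* The elements supported in [U] together with those supported off [U]
   generate the unit ideal; splitting [1 = j + k] accordingly gives
   [j * k = 0], so that [j] is idempotent with support [U]. *)
Lemma clopen_idempotent (hR : reduced R) U : clopen U ->
  exists2 e, idempotents R e & supp e = U.
Proof.
move=> [oU cU]; have oUc : open (~` U) by rewrite openC.
have [J0 JD JM] := ideal_supp_sub U; have [K0 KD KM] := ideal_supp_sub (~` U).
pose L := [set r | exists j k, [/\ supp j `<=` U, supp k `<=` ~` U & r = j + k]].
have [||j [k [jU kU jk1]]] := @ideal_in_no_prime L.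
- split; first by exists 0, 0; rewrite addr0.
  + move=> _ _ [j [k [jU kU ->]]] [j' [k' [jU' kU' ->]]].
    exists (j + j'), (k + k'); rewrite addrACA.
    by split; [exact: JD|exact: KD|].
  + move=> a _ [j [k [jU kU ->]]]; exists (a * j), (a * k).
    by split; [exact: JM|exact: KM|rewrite mulrDr].
(* Whichever of the two open sets contains [P], a basic neighbourhood [supp a] inside it puts [a] in
   [L] but not in [P]. *)
- move=> P LP; have [UP|UP] := pselect (U P).
    have [a Pa aU] := nbhs_supp _ _ (open_nbhs_nbhs (conj oU UP)).
    by apply/Pa/LP; exists a, 0; rewrite addr0.
  have [a Pa aU] := nbhs_supp _ _ (open_nbhs_nbhs (conj oUc UP)).
  by apply/Pa/LP; exists 0, a; rewrite add0r.
have jk0 : j * k = 0.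
  by apply: supp_eq0 => //; rewrite suppM -subset0 => P [/jU ? /kU].
exists j; first by rewrite /idempotents /= -[RHS]mulr1 jk1 mulrDr jk0 addr0.
apply/seteqP; split=> // P UP.
(* At a point of [U] the prime contains [k], so it cannot contain [j]. *)
have : supp (1 : R) P by rewrite supp1.
by rewrite jk1 => /suppD[//|/kU].
Qed.

Lemma Ann_supp (hR : reduced R) S r :
  Ann S r <-> supp r `&` \bigcup_(s in S) supp s = set0.
Proof.
split=> [rS|rS s Ss].
  rewrite -subset0 => P [Pr [s Ss Ps]].
  have : supp (r * s) P by rewrite suppM.
  by rewrite rS // supp0.
apply: supp_eq0 => //; rewrite suppM -subset0 => P [Pr Ps].
by rewrite -rS; split=> //; exists s.
Qed.

(** The basic neighbourhoods of [P] are the [supp r] with [r] outside [P], and [supp r] misses the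
    union exactly when [r] annihilates [S]. *)
Lemma closure_supp (hR : reduced R) S (P : Spec R) :
  closure (\bigcup_(s in S) supp s) P <-> Ann S `<=` spec_set P.
Proof.
split=> [clP r /(Ann_supp hR) rS|SP V /nbhs_supp[r Pr rV]].
  apply: contrapT => Pr.
  have [Q [SQ rQ]] := clP _ (open_nbhs_nbhs (conj (open_supp r) Pr)).
  by have : (supp r `&` \bigcup_(s in S) supp s) Q by []; rewrite rS.
apply: contrapT => disj; apply/Pr/SP/(Ann_supp hR).
by rewrite -subset0 => Q [/rV VQ SQ]; apply: disj; exists Q.
Qed.

Lemma closure_supp_eq (hR : reduced R) S T :
  closure (\bigcup_(s in S) supp s) = closure (\bigcup_(t in T) supp t) <->
  Ann S = Ann T.
Proof.
split=> ST; apply/funext=> x; apply/propext.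
  have clE V := open_disjoint_closure _ _ V (open_supp x).
  by rewrite !(Ann_supp hR) -[X in X <-> _]clE ST clE.
by rewrite !(closure_supp hR) ST.
Qed.

(** Serves to pass from the condition on ideals to the one on single elements. *)
Lemma Ann_principal a : Ann [set b * a | b in setT] = Ann [set a].
Proof.
apply/seteqP; split=> r ra /=; last first.
  by move=> _ [b _ <-]; rewrite mulrCA ra ?mulr0.
by move=> _ ->; apply: ra; exists 1; rewrite ?mul1r.
Qed.

Lemma ideal_principal a : ideal [set b * a | b in setT].
Proof.
split; first by exists 0; rewrite ?mul0r.
- by move=> _ _ [b _ <-] [c _ <-]; exists (b + c); rewrite ?mulrDl.
- by move=> c _ [b _ <-]; exists (c * b); rewrite ?mulrA.
Qed.

End SpecTopology.

Theorem theorem4p2 (R : comPzRingType) (hR : reduced R) :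
  [<-> (* (a) *)
       ez_space (Spec R);
       (* (b) *)
       forall I : set R, ideal I ->
         exists2 E : set R, E `<=` idempotents R & Ann I = Ann E;
       (* (c) *)
       forall a : R,
         exists2 S : set R, S `<=` idempotents R & Ann [set a] = Ann S;
       (* (d) *)
       forall a : R,
         exists2 S : set R, S `<=` idempotents R &
           closure (supp a) = closure (\bigcup_(e in S) supp e)].
Proof.
tfae.
- move=> ez I idI.
  have [|F Fclopen IF] := ez (\bigcup_(a in I) supp a).
    by apply: bigcup_open => a _; exact: open_supp.
  (* Every clopen set in [F] is the support of an idempotent, so these supports have the same union
     as [F]. *)
  exists [set e | idempotents R e /\ F (supp e)]; first by move=> e [].
  apply/(closure_supp_eq _ hR); rewrite IF; congr closure.
  apply/seteqP; split=> [P [U FU UP]|P [e [_ Fe] Pe]]; last by exists (supp e).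
  have [e ide eU] := clopen_idempotent _ hR _ (Fclopen _ FU).
  by exists e => /=; rewrite eU.
- by move=> b a; rewrite -Ann_principal; apply: b; exact: ideal_principal.
- move=> c a; have [S Sid aS] := c a; exists S => //.
  by have /(closure_supp_eq _ hR) := aS; rewrite bigcup_set1.
- move=> d A oA.
  (* Take all idempotent supports inside [closure A]. Each point of [A] has a neighbourhood [supp a]
     within [A], and the idempotents that (d) gives for [a] have supports in [closure (supp a)],
     hence in [closure A]. *)
  exists [set supp e | e in [set e | idempotents R e /\ supp e `<=` closure A]].
    by move=> _ [e [ide _] <-]; exact: clopen_supp.
  rewrite bigcup_image; apply/seteqP; split.
    rewrite [X in X `<=` _]closureE.
    apply: smallest_sub; first exact: closed_closure.
    move=> P /(fun AP => nbhs_supp _ _ _ (open_nbhs_nbhs (conj oA AP)))[a Pa aA].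
    have [S Sid aS] := d a.
    have : closure (supp a) P by exact: subset_closure.
    rewrite aS; apply: closureS => Q [e Se Qe]; exists e => //; split.
      exact: Sid.
    move=> Q' Qe'; apply: (closureS aA); rewrite aS.
    by apply: subset_closure; exists e.
  rewrite [X in X `<=` _]closureE.
  apply: smallest_sub; first exact: closed_closure.
  by move=> P [e [_ eA] /eA].
Qed.
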